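(* Let $N$ be a positive integer such that $N\equiv 5\pmod 6$ and $N\notin\{5,11\}$. Then there exists an antipodal $5$-design with $2N+1$ rational points for the Chebyshev measure $(1-t^2)^{-1/2}dt/\pi$ on $(-1,1)$.
   Context: An $m$-design with $n$ points for a probability measure $w(t)dt$ on an interval $I$ is a set of $n$ pairwise distinct points $x_1,\dots,x_n\in I$ with $\frac1n\sum_i f(x_i)=\int_I f(t)w(t)dt$ for every real polynomial $f$ of degree at most $m$. It is rational if all $x_i\in\mathbb{Q}$ and antipodal if $\{x_i\}=\{-x_i\}$. *)

(* Defs.v *)
From HB Require Import structures.
From mathcomp Require Export all_boot all_order all_algebra.
From mathcomp Require Export all_classical all_reals all_analysis.

Set Implicit Arguments.
Unset Strict Implicit.
Unset Printing Implicit Defensive.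

Import Order.TTheory GRing.Theory Num.Theory.
Import numFieldNormedType.Exports.

Local Open Scope ring_scope.

(* The integral is the extended-real Lebesgue integral, so that the equation
   also forces its value to be finite. No separate hypothesis says that
   w(t)dt has mass 1: for n > 0 this is the case f = 1. *)
Definition is_design (R : realType) (w : R -> R) (I : interval R) (m n : nat)
    (x : n.-tuple R) : Prop :=
  [/\ uniq x,
      (forall i : 'I_n, tnth x i \in I) &
      forall f : {poly R}, (size f <= m.+1)%N ->
        ((n%:R^-1 * \sum_(i < n) f.[tnth x i])%:E =
         \int[lebesgue_measure]_(t in [set` I]) (f.[t] * w t)%:E)%E].

Definition rational_points (R : realType) (n : nat) (x : n.-tuple R) : Prop :=
  forall i : 'I_n, rational (tnth x i).

Definition antipodal (R : realType) (n : nat) (x : n.-tuple R) : Prop :=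
  x =i [seq - y | y <- x].

Definition chebyshev_density (R : realType) (t : R) : R :=
  (Num.sqrt (1 - t ^+ 2))^-1 / pi.

(* Main.v *)
(* Besides 0 we take points +-y with y in (0,1) rational; by symmetry the design
   property reduces to the two equations sum y^2 = (2N+1)/4 and
   sum y^4 = 3(2N+1)/16. For N = 17 an explicit solution is given. The
   projections of a regular hexagon inscribed in the unit circle form an
   antipodal 5-design with 6 points; infinitely many of these are rational and
   they are pairwise disjoint, so N can always be increased by 3 with a hexagon
   that avoids the points already used. The moments of the Chebyshev measure
   come from primitives of the form c asin t + q(t) sqrt(1 - t^2). *)

Require Import Defs.
From mathcomp Require Import measurable_realfun ring lra zify.

Set Implicit Arguments.
Unset Strict Implicit.
Unset Printing Implicit Defensive.

Import Order.TTheory GRing.Theory Num.Theory.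
Import numFieldNormedType.Exports.

Local Open Scope classical_set_scope.
Local Open Scope ring_scope.

(** * Rational hexagons inscribed in the unit circle *)

(* With cos t = (k^2-3)/(k^2+3) and sin t = 2 sqrt 3 k/(k^2+3), these are
   cos t, cos (pi/3 - t) and cos (pi/3 + t); the condition 7 <= k used below
   keeps t in (0, pi/6). *)
Definition hexagon (F : realFieldType) (k : F) : seq F :=
  [:: (k ^+ 2 - 3) / (k ^+ 2 + 3);
      (k ^+ 2 + 6 * k - 3) / (2 * (k ^+ 2 + 3));
      (k ^+ 2 - 6 * k - 3) / (2 * (k ^+ 2 + 3))].

(** The sums 3/2 here and 9/8 below are the growth of (2n+1)/4 and 3(2n+1)/16 when n increases by
    3. *)
Lemma hexagon_sum2 (F : realFieldType) (k : F) : \sum_(x <- hexagon k) x ^+ 2 = 3 / 2.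
Proof.
have k3 : k ^+ 2 + 3 != 0 by rewrite gt_eqF// ltr_wpDl ?sqr_ge0.
rewrite !big_cons big_nil addr0; field; exact: k3.
Qed.

Lemma hexagon_sum4 (F : realFieldType) (k : F) : \sum_(x <- hexagon k) x ^+ 4 = 9 / 8.
Proof.
have k3 : k ^+ 2 + 3 != 0 by rewrite gt_eqF// ltr_wpDl ?sqr_ge0.
rewrite !big_cons big_nil addr0; field; exact: k3.
Qed.

(** This and the next two bounds put the three points in disjoint intervals. The value 7/8 is a
    rational stand-in for cos(pi/6), and 7 is the least integer above 3 + 2 sqrt 3, the parameter at
    which t = pi/6. *)
Lemma hexagon0_bound (F : realFieldType) (k : F) : 7 <= k ->
  7 / 8 < (k ^+ 2 - 3) / (k ^+ 2 + 3) < 1.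
Proof.
move=> k7; have k3 : 0 < k ^+ 2 + 3 by nra.
by rewrite ltr_pdivlMr// ltr_pdivrMr//; apply/andP; split; nra.
Qed.

Lemma hexagon1_bound (F : realFieldType) (k : F) : 7 <= k ->
  1 / 2 < (k ^+ 2 + 6 * k - 3) / (2 * (k ^+ 2 + 3)) < 7 / 8.
Proof.
move=> k7; have k3 : 0 < 2 * (k ^+ 2 + 3) by nra.
by rewrite ltr_pdivlMr// ltr_pdivrMr//; apply/andP; split; nra.
Qed.

Lemma hexagon2_bound (F : realFieldType) (k : F) : 7 <= k ->
  0 < (k ^+ 2 - 6 * k - 3) / (2 * (k ^+ 2 + 3)) < 1 / 2.
Proof.
move=> k7; have k3 : 0 < 2 * (k ^+ 2 + 3) by nra.
by rewrite ltr_pdivlMr// ltr_pdivrMr//; apply/andP; split; nra.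
Qed.

Lemma hexagon_uniq (F : realFieldType) (k : F) : 7 <= k -> uniq (hexagon k).
Proof.
move=> k7; rewrite /= !inE negb_or.
move: (hexagon0_bound k7) (hexagon1_bound k7) (hexagon2_bound k7).
move=> /andP[a1 _] /andP[b1 b2] /andP[_ c2].
rewrite (gt_eqF (lt_trans b2 a1)) (gt_eqF (lt_trans c2 b1)).
by rewrite (gt_eqF (lt_trans (lt_trans c2 b1) (lt_trans b2 a1))).
Qed.

Lemma hexagon_bound (F : realFieldType) (k : F) : 7 <= k -> all (fun x => 0 < x < 1) (hexagon k).
Proof.
move=> k7 /=.
move: (hexagon0_bound k7) (hexagon1_bound k7) (hexagon2_bound k7).
by move=> *; rewrite andbT; apply/and3P; split; lra.
Qed.

Lemma hexagon_inj (F : realFieldType) (k l x : F) : 7 <= k -> 7 <= l ->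
  x \in hexagon k -> x \in hexagon l -> k = l.
Proof.
move=> k7 l7; have k3 : k ^+ 2 + 3 != 0 by rewrite gt_eqF//; nra.
have l3 : l ^+ 2 + 3 != 0 by rewrite gt_eqF//; nra.
(* Up to a nonzero constant, cross-multiplying two equal points in the same position gives k - l
   times one of these three factors. *)
have pos0 : 0 < k + l by lra.
have pos1 : 0 < k * l - k - l - 3 by nra.
have pos2 : 0 < k * l + k + l - 3 by nra.
move: (hexagon0_bound k7) (hexagon1_bound k7) (hexagon2_bound k7).
move: (hexagon0_bound l7) (hexagon1_bound l7) (hexagon2_bound l7).
rewrite !inE => La Lb Lc Ka Kb Kc.
have cancel (v : F) : 0 < v -> (k - l) * v = 0 -> k = l.
  by move=> v0 /eqP; rewrite mulf_eq0 (gt_eqF v0) orbF subr_eq0 => /eqP.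
(* The bounds separate points coming from different positions. *)
move=> /or3P[]/eqP xk /or3P[]/eqP xl;
  rewrite -?xk -?xl in La Lb Lc Ka Kb Kc; try lra.
- have /eqP := etrans (esym xk) xl; rewrite eqr_div// => /eqP E.
  by apply: (cancel _ pos0); lra.
- have /eqP := etrans (esym xk) xl.
  rewrite eqr_div ?mulf_neq0 ?pnatr_eq0// => /eqP E.
  by apply: (cancel _ pos1); lra.
- have /eqP := etrans (esym xk) xl.
  rewrite eqr_div ?mulf_neq0 ?pnatr_eq0// => /eqP E.
  by apply: (cancel _ pos2); lra.
Qed.

(** By [hexagon_inj] a point of [s] lies on at most one hexagon with parameter at least 7, so only
    finitely many parameters are bad. Asking for all l >= k carries the induction on [s]. *)
Lemma hexagon_fresh (F : realFieldType) (s : seq F) :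
  exists2 k : F, 7 <= k & forall l, k <= l -> ~~ has (mem s) (hexagon l).
Proof.
elim: s => [|x s [k k7 sk]].
  by exists 7 => // l _; apply/hasPn => y; rewrite inE.
have [[l [l7 xl]]|nx] := EM (exists l, 7 <= l /\ x \in hexagon l); last first.
  exists k => // l kl; apply/hasPn => y yl; rewrite !inE negb_or.
  rewrite (hasPn (sk _ kl))// andbT; apply: contra_notN nx => /eqP <-.
  by exists l; split => //; exact: le_trans kl.
exists (Num.max k (l + 1)); first by rewrite le_max k7.
move=> m; rewrite ge_max => /andP[km lm].
apply/hasPn => y ym; rewrite !inE negb_or (hasPn (sk _ km))// andbT.
apply/negP => /eqP yx; rewrite yx in ym.
by have := hexagon_inj (le_trans k7 km) l7 ym xl; lra.
Qed.

(** * Positive halves of antipodal designs *)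

(** The positive points of a design made of 0 and the +-y. The sums are 2n+1 times the moments 1/2
    and 3/8, halved since y and -y contribute equally. *)
Record half_design (n : nat) (s : seq rat) : Prop := HalfDesign {
  half_size : size s = n;
  half_uniq : uniq s;
  half_bound : all (fun x => 0 < x < 1) s;
  half_sum2 : \sum_(x <- s) x ^+ 2 = (2 * n + 1)%:R / 4;
  half_sum4 : \sum_(x <- s) x ^+ 4 = 3 * (2 * n + 1)%:R / 16 }.

Lemma half_design_add3 (n : nat) (s : seq rat) :
  half_design n s -> exists t, half_design (n + 3) t.
Proof.
case=> sn us bs s2 s4; have [k k7 /(_ k (lexx k)) ks] := hexagon_fresh s.
exists (s ++ hexagon k); split.
- by rewrite size_cat sn.
- by rewrite cat_uniq us ks hexagon_uniq.
- by rewrite all_cat bs hexagon_bound.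
- by rewrite big_cat/= hexagon_sum2 s2 !(natrD, natrM); field.
- by rewrite big_cat/= hexagon_sum4 s4 !(natrD, natrM); field.
Qed.

(* Found by computer search: 84 is twice a multiple of 6, and 16 of the 17
   numerators are odd; both are forced by congruences modulo 16 and 3. *)
Definition seed : seq nat :=
  [:: 3; 19; 21; 29; 39; 41; 45; 51; 67; 69; 71; 75; 77; 79; 81; 82; 83].

Lemma half_design17 : half_design 17 [seq a%:R / 84 | a <- seed].
Proof.
split; first by rewrite size_map.
- rewrite map_inj_uniq// => a b /(mulIf _) /eqP.
  by rewrite invr_eq0 pnatr_eq0 => /(_ isT); rewrite eqr_nat => /eqP.
- rewrite all_map; apply/allP => a aS /=.
  have /andP[a0 a84] : (0 < a < 84)%N by move: a aS; apply/allP.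
  by rewrite divr_gt0 ?ltr0n// ltr_pdivrMr ?ltr0n// mul1r ltr_nat.
- by rewrite big_map !big_cons big_nil; field.
- by rewrite big_map !big_cons big_nil; field.
Qed.

Lemma exists_half_design (N : nat) : (N %% 6 = 5)%N -> N <> 5%N -> N <> 11%N ->
  exists s, half_design N s.
Proof.
move=> N6 N5 N11.
(* The hypotheses force N >= 17, so the truncated subtraction is exact; each step of 6 is made by
   two hexagons. *)
have -> : N = (17 + 3 * ((N %/ 6 - 2) * 2))%N by lia.
elim: (_ * 2)%N => [|m [s /half_design_add3]]; last by rewrite -addnA -mulnSr.
by exists [seq a%:R / 84 | a <- seed]; exact: half_design17.
Qed.

(** * The fundamental theorem of calculus on an open interval *)

(** The endpoints matter: the primitive is evaluated at -1 and 1, where asin is not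
    differentiable. *)
Lemma within_continuous_asin (R : realType) :
  {within `[(-1 : R), 1], continuous (@asin R)}.
Proof.
have := @segment_can_le_continuous R (- (pi / 2)) (pi / 2) sin asin.
rewrite sinN sin_pihalf; apply; last exact: sinK.
- have := pi_gt0 R; lra.
- exact/continuous_subspaceT/continuous_sin.
Qed.

(** Since [f] may blow up at [a] and [b], the compact version is applied on closed intervals
    exhausting the open one. Monotone convergence handles the integrals, continuity of [F] the
    boundary values. *)
Lemma ge0_continuous_FTC2oo (R : realType) (f F : R -> R) (a b : R) : a < b ->
  {in `]a, b[, forall x, 0 <= f x} -> {in `]a, b[, continuous f} ->
  {in `]a, b[, forall x : R, is_derive x 1 F (f x)} ->
  {within `[a, b], continuous F} ->
  (\int[lebesgue_measure]_(x in `]a, b[) (f x)%:E = (F b - F a)%:E)%E.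
Proof.
move=> ab f0 cf dF cF.
(* A third of the length keeps u n < v n even at n = 0, where [harmonic] is 1. *)
pose e : R := (b - a) / 3.
have e0 : 0 < e by rewrite divr_gt0// subr_gt0.
pose u n := a + e * harmonic n; pose v n := b - e * harmonic n.
have h0 n : 0 < e * harmonic n by rewrite mulr_gt0// invr_gt0.
have h1 n : e * harmonic n <= e.
  by rewrite ger_pMr// /harmonic/= invf_le1 ?ltr0n// ler1n.
have eh0 : e * harmonic n @[n --> \oo] --> 0.
  by rewrite -[0](mulr0 e); apply: cvgMr; exact: cvg_harmonic.
have ua : u n @[n --> \oo] --> a.
  by rewrite -[X in _ --> X](addr0 a); apply: cvgD => //; exact: cvg_cst.
have vb : v n @[n --> \oo] --> b.
  by rewrite -[X in _ --> X](subr0 b); apply: cvgB => //; exact: cvg_cst.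
have au n : a < u n by rewrite ltrDl.
have vbn n : v n < b by rewrite gtrBl.
have uv n : u n < v n by rewrite /u /v; have := h1 n; rewrite /e; lra.
have sub n : `[u n, v n] `<=` `]a, b[.
  move=> x /=; rewrite !in_itv/= => /andP[ux xv].
  by rewrite (lt_le_trans (au n))// (le_lt_trans xv).
have UE : `]a, b[%classic = \bigcup_n `[u n, v n]%classic.
  apply/seteqP; split=> x /=; last by move=> [n _ /sub].
  rewrite in_itv/= => /andP[ax xb].
  have : \forall n \near \oo, u n < x /\ x < v n.
    by apply: filterI; [exact: (cvgr_lt _ ua) | exact: (cvgr_gt _ vb)].
  move=> /filter_ex[n [un nv]]; exists n => //=.
  by rewrite in_itv/= !ltW.
have int n : (\int[lebesgue_measure]_(x in `[u n, v n]) (f x)%:E =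
    (F (v n) - F (u n))%:E)%E.
  have /continuous_within_itvP -/(_ (uv n))[_ Fu Fv] :
      {within `[u n, v n], continuous F}.
    apply: continuous_subspaceW cF => x /sub /=.
    by rewrite !in_itv/= => /andP[/ltW -> /ltW ->].
  rewrite EFinB; apply: continuous_FTC2 => //.
  - by apply: continuous_in_subspaceT => x /[!inE] /sub; exact: cf.
  - split=> // x /subset_itv_oo_cc /sub xab.
    by have := dF _ xab => -[].
  - move=> x /subset_itv_oo_cc /sub xab.
    by rewrite derive1E; have := dF _ xab => -[_ ->].
have mf : measurable_fun `]a, b[ f.
  by apply: open_continuous_measurable_fun => // x /[!inE]; exact: cf.
have cvg1 : (\int[lebesgue_measure]_(x in `[u n, v n]) (f x)%:E)%E @[n --> \oo]
    --> (\int[lebesgue_measure]_(x in `]a, b[) (f x)%:E)%E.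
  rewrite [X in (\int[_]_(_ in X) _)%E]UE.
  apply: ge0_nondecreasing_set_cvg_integral => //.
  - apply/nondecreasing_seqP => n; rewrite subsetEset.
    apply: subset_itv; rewrite bnd_simp.
    + by rewrite lerD2l ler_pM2l// lef_pV2 ?posrE ?ltr0n// ler_nat.
    + by rewrite lerD2l lerN2 ler_pM2l// lef_pV2 ?posrE ?ltr0n// ler_nat.
  - by move=> n; apply/measurable_EFinP; apply: measurable_funS mf.
  - by move=> n x /sub xab; rewrite lee_fin f0.
have cvg2 : (\int[lebesgue_measure]_(x in `[u n, v n]) (f x)%:E)%E @[n --> \oo]
    --> (F b - F a)%:E.
  under eq_cvg do rewrite int.
  apply: cvg_EFin; first exact: nearW.
  move/(continuous_within_itvP _ ab) : cF => [_ Fa Fb].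
  apply: cvgB.
  - by move/cvg_at_leftP: Fb; apply.
  - by move/cvg_at_rightP: Fa; apply.
exact: cvg_unique cvg1 cvg2.
Qed.

(** * Moments of the Chebyshev measure *)

Lemma is_derive_chebyshev (R : realType) (c : R) (q : {poly R}) (t : R) :
  -1 < t < 1 ->
  is_derive t 1 (fun t => (c * asin t + q.[t] * Num.sqrt (1 - t ^+ 2)) / pi)
    ((c%:P + q^`() * (1 - 'X ^+ 2) - 'X * q).[t] * chebyshev_density t).
Proof.
move=> t1.
have t2 : 0 < 1 - t ^+ 2 by case/andP: t1 => *; nra.
have s0 : Num.sqrt (1 - t ^+ 2) != 0 by rewrite gt_eqF// sqrtr_gt0.
have d2 : is_derive t 1 (fun t : R => 1 - t ^+ 2) (- (2 * t)).
  have := is_derive_poly (1 - 'X ^+ 2) t.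
  rewrite derivB -polyC1 derivC derivXn sub0r expr1.
  rewrite (_ : horner _ = fun t : R => 1 - t ^+ 2); last first.
    by apply/funext => x; rewrite !hornerE.
  by rewrite hornerN hornerMn hornerX mulr_natl.
have d3 : is_derive t 1 (fun t : R => Num.sqrt (1 - t ^+ 2))
    ((2 * Num.sqrt (1 - t ^+ 2))^-1 * - (2 * t)).
  exact: (@is_derive1_comp R Num.sqrt (fun t : R => 1 - t ^+ 2) t _ _
    (is_derive1_sqrt t2) d2).
have d1 := is_derive1_asin t1.
have d4 := is_derive_poly q t.
(* Written with operations on functions, the primitive gets its derivative by instance inference. *)
have -> : (fun t => (c * asin t + q.[t] * Num.sqrt (1 - t ^+ 2)) / pi) =
   pi^-1 \*: (c \*: (@asin R) + horner q * (fun t : R => Num.sqrt (1 - t ^+ 2))).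
  by apply/funext => x; rewrite !fctE /GRing.scale/= mulrC.
apply: is_derive_eq.
rewrite !hornerE /chebyshev_density /GRing.scale/=.
have s2 := sqr_sqrtr (ltW t2).
have p0 : pi != 0 :> R by rewrite gt_eqF ?pi_gt0.
(* Replacing 1 - t^2 by s^2 leaves an identity of rational functions. *)
set s := Num.sqrt _ in s0 s2 *; rewrite -s2.
by move: (pi : R) p0 => p p0; field; rewrite s0 p0.
Qed.

(** The moments of order 0, 2, 4 are 1, 1/2, 3/8 and the odd ones vanish, so this is the integral of
    [f] in degree at most 5. *)
Definition chebyshev_mean (R : realType) (f : {poly R}) : R :=
  f`_0 + f`_2 / 2 + 3 * f`_4 / 8.

Lemma horner_size6 (R : realType) (f : {poly R}) (t : R) : (size f <= 6)%N ->
  f.[t] = f`_0 + f`_1 * t + f`_2 * t ^+ 2 + f`_3 * t ^+ 3 + f`_4 * t ^+ 4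
          + f`_5 * t ^+ 5.
Proof.
by move=> f6; rewrite (horner_coef_wide _ f6) !big_ord_recr big_ord0/=; ring.
Qed.

(** With t = sin u, the terms come from the reduction formulas for the primitives of sin^j u, j = 1,
    ..., 5, without their multiple of u and divided by cos u. *)
Definition chebyshev_cofactor (R : realType) (f : {poly R}) : {poly R} :=
  - ((f`_1)%:P + (f`_2 / 2) *: 'X + (f`_3 / 3) *: ('X^2 + 2%:P)
     + (f`_4 / 8) *: (2 *: 'X^3 + 3 *: 'X)
     + (f`_5 / 15) *: (3 *: 'X^4 + 4 *: 'X^2 + 8%:P)).

(* The derivative of c asin t + q(t) sqrt(1 - t^2) is
   (c + q'(t) (1 - t^2) - t q(t)) / sqrt(1 - t^2). *)
Lemma chebyshev_cofactorE (R : realType) (f : {poly R}) (t : R) :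
  (size f <= 6)%N -> let q := chebyshev_cofactor f in
  ((chebyshev_mean f)%:P + q^`() * (1 - 'X^2) - 'X * q).[t] = f.[t].
Proof.
move=> f6 /=; rewrite (horner_size6 _ f6) /chebyshev_cofactor /chebyshev_mean.
rewrite derivN !(derivD, derivZ, derivC, derivX, derivXn) !hornerE/=.
by rewrite ?hornerMn ?hornerXn ?hornerX; field.
Qed.

Lemma continuous_sqrt_1B2 (R : realType) :
  continuous (fun t : R => Num.sqrt (1 - t ^+ 2)).
Proof.
move=> t; apply: (@continuous_comp _ _ _ (fun t : R => 1 - t ^+ 2) Num.sqrt).
  by apply: cvgB; [exact: cvg_cst | exact: exprn_continuous].
exact: sqrt_continuous.
Qed.

Lemma chebyshev_density_ge0 (R : realType) (t : R) : 0 <= chebyshev_density t.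
Proof. by rewrite divr_ge0 ?invr_ge0 ?sqrtr_ge0 ?pi_ge0. Qed.

Lemma continuous_chebyshev (R : realType) (f : {poly R}) :
  {in `]-1, 1[, continuous (fun t => f.[t] * chebyshev_density t)}.
Proof.
move=> t; rewrite in_itv/= => t1; rewrite /chebyshev_density.
apply: cvgM; first exact: continuous_horner.
apply: cvgMl; apply: cvgV.
  by rewrite gt_eqF// sqrtr_gt0; case/andP: t1 => *; nra.
exact: continuous_sqrt_1B2.
Qed.

Lemma ge0_chebyshev_integral (R : realType) (f : {poly R}) : (size f <= 6)%N ->
  {in `]-1, 1[, forall t, 0 <= f.[t]} ->
  (\int[lebesgue_measure]_(t in `](-1)%R, 1%R[) (f.[t] * chebyshev_density t)%:E =
   (chebyshev_mean f)%:E)%E.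
Proof.
move=> f6 f0; pose c := chebyshev_mean f; pose q := chebyshev_cofactor f.
have pi0 := pi_gt0 R.
have asin1 : asin 1 = pi / 2 :> R.
  have := @sinK R (pi / 2); rewrite sin_pihalf; apply.
  by rewrite in_itv/=; apply/andP; split; lra.
have asinN1 : asin (-1) = - (pi / 2) :> R.
  have := @sinK R (- (pi / 2)); rewrite sinN sin_pihalf; apply.
  by rewrite in_itv/=; apply/andP; split; lra.
rewrite (@ge0_continuous_FTC2oo _ _
  (fun t => (c * asin t + q.[t] * Num.sqrt (1 - t ^+ 2)) / pi)).
(* The square root vanishes at both ends, so only c (asin 1 - asin (-1)) / pi = c survives. *)
- rewrite asin1 asinN1 sqrrN expr1n subrr sqrtr0 !mulr0 !addr0; congr EFin.
  rewrite -/c; have : pi != 0 :> R by rewrite gt_eqF ?pi_gt0.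
  by move: (pi : R) => p p0; field.
- lra.
- by move=> t t1; rewrite mulr_ge0 ?f0 ?chebyshev_density_ge0.
- exact: continuous_chebyshev.
- move=> t; rewrite in_itv/= => t1.
  by have := is_derive_chebyshev c q t1; rewrite chebyshev_cofactorE.
- move=> t; apply: cvgMl; apply: cvgD.
    by apply: cvgMr; exact: within_continuous_asin.
  apply: (@continuous_subspaceT _ _ _
    (fun t : R => q.[t] * Num.sqrt (1 - t ^+ 2))) => {}t.
  by apply: cvgM; [exact: continuous_horner | exact: continuous_sqrt_1B2].
Qed.

Lemma chebyshev_integral (R : realType) (f : {poly R}) : (size f <= 6)%N ->
  (\int[lebesgue_measure]_(t in `](-1)%R, 1%R[) (f.[t] * chebyshev_density t)%:E =
   (chebyshev_mean f)%:E)%E.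
Proof.
(* Adding a constant reduces to the nonnegative case. *)
move=> f6.
have [C C0 fC] : exists2 C : R, 0 <= C &
    {in `]-1, 1[, forall t, - C <= f.[t]}.
  (* All powers of t are at most 1 in absolute value on (-1, 1). *)
  exists (\sum_(i < 6) `|f`_i|) => [|t]; first exact: sumr_ge0.
  rewrite in_itv/= -ltr_norml => t1.
  apply: le_trans (_ : - `|f.[t]| <= _); last by rewrite lerNl ler_normr lexx orbT.
  rewrite lerN2 (horner_coef_wide _ f6) (le_trans (ler_norm_sum _ _ _))//.
  apply: ler_sum => i _; rewrite normrM normrX ler_piMr//.
  by rewrite exprn_ile1// ltW.
have C6 : (size (C%:P : {poly R}) <= 6)%N.
  by rewrite (leq_trans (size_polyC_leq1 _)).
have fC6 : (size (f + C%:P)%R <= 6)%N.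
  by rewrite (leq_trans (size_polyD _ _))// geq_max f6.
(* Splitting the integral needs integrability, which follows from the finite value in the
   nonnegative case. *)
have integrable (p : {poly R}) : (size p <= 6)%N ->
    {in `]-1, 1[, forall t, 0 <= p.[t]} ->
    (@lebesgue_measure R).-integrable `](-1), 1[
      (fun t => (p.[t] * chebyshev_density t)%:E).
  move=> p6 p0; apply/integrableP; split.
    apply/measurable_EFinP; apply: open_continuous_measurable_fun => //.
    by move=> t /[!inE]; exact: continuous_chebyshev.
  under eq_integral => t t1.
    rewrite gee0_abs; last first.
      rewrite inE in t1; rewrite lee_fin; apply: mulr_ge0; first exact: p0.
      exact: chebyshev_density_ge0.
    over.
  by rewrite ge0_chebyshev_integral// ltry.
have fC0 : {in `]-1, 1[, forall t, 0 <= (f + C%:P).[t]}.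
  by move=> t /fC; rewrite !hornerE -subr_ge0 opprK.
have CC0 : {in `]-1, 1[, forall t, 0 <= (C%:P : {poly R}).[t]}.
  by move=> t _; rewrite hornerC.
transitivity (\int[lebesgue_measure]_(t in `](-1)%R, 1%R[)
    (((f + C%:P).[t] * chebyshev_density t)%:E -
     ((C%:P).[t] * chebyshev_density t)%:E))%E.
  by apply: eq_integral => t _; rewrite -EFinB -mulrBl !hornerE addrK.
rewrite integralB//; [|exact: integrable|exact: integrable].
rewrite !ge0_chebyshev_integral// -EFinB /chebyshev_mean !coefD !coefC/=.
by congr EFin; ring.
Qed.

(** * The symmetric point set and its design property *)

Definition antipodal_seq (R : realType) (s : seq rat) : seq R :=
  let r := [seq ratr y | y <- s] in 0 :: r ++ [seq - y | y <- r].

Lemma antipodal_seq_uniq (R : realType) (s : seq rat) :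
  uniq s -> all (fun x => 0 < x < 1) s -> uniq (antipodal_seq R s).
Proof.
move=> us /allP s01; pose r : seq R := [seq ratr y | y <- s].
have r0 y : y \in r -> 0 < y.
  by move=> /mapP[z zs ->]; rewrite ltr0q; case/andP: (s01 _ zs).
have ur : uniq r by rewrite map_inj_uniq//; exact: fmorph_inj.
rewrite /antipodal_seq -/r /= cat_uniq ur (map_inj_uniq oppr_inj) ur andbT /=.
apply/andP; split.
  rewrite mem_cat negb_or; apply/andP; split.
    by apply/negP => /r0; rewrite ltxx.
  by apply/negP => /mapP[y /r0 y0 /eqP]; rewrite eq_sym oppr_eq0 gt_eqF.
apply/hasPn => _ /mapP[y /r0 y0 ->]; apply/negP => /r0.
by rewrite oppr_gt0 ltNge ltW.
Qed.

Lemma antipodal_seq_bound (R : realType) (s : seq rat) (x : R) :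
  all (fun x => 0 < x < 1) s -> x \in antipodal_seq R s -> -1 < x < 1.
Proof.
move=> /allP s01.
have r01 y : y \in [seq ratr y | y <- s] -> (0 : R) < y < 1.
  by move=> /mapP[z /s01 z01 ->]; rewrite -(rmorph0 ratr) -(rmorph1 ratr) !ltr_rat.
rewrite inE mem_cat => /or3P[/eqP ->|/r01|/mapP[y /r01 + ->]]; lra.
Qed.

(** Pairing y with -y cancels the odd terms, and the point 0 adds the constant coefficient once
    more, turning 2n into 2n+1. *)
Lemma antipodal_seq_sum (R : realType) (n : nat) (s : seq rat) (f : {poly R}) :
  half_design n s -> (size f <= 6)%N ->
  \sum_(x <- antipodal_seq R s) f.[x] = (2 * n + 1)%:R * chebyshev_mean f.
Proof.
case=> sn _ _ s2 s4 f6; rewrite /antipodal_seq big_cons big_cat/= !big_map.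
rewrite -big_split/= horner_coef0.
rewrite (eq_bigr (fun y => 2 * f`_0 + 2 * f`_2 * ratr (y ^+ 2)
                           + 2 * f`_4 * ratr (y ^+ 4))); last first.
  by move=> y _; rewrite !(horner_size6 _ f6) !rmorphXn/=; ring.
rewrite !big_split/= -!mulr_sumr -!rmorph_sum/= s2 s4.
rewrite big_const_seq count_predT sn iter_addr_0 /chebyshev_mean.
rewrite !(fmorph_div, rmorphM, rmorph_nat) !(natrD, natrM) -mulr_natr.
by field.
Qed.

Theorem theorem8p2 (R : realType) (N : nat) (N_gt0 : (0 < N)%N)
    (N_mod6 : N = 5 %[mod 6]) (N_neq5 : N <> 5%N) (N_neq11 : N <> 11%N) :
  exists x : (2 * N + 1).-tuple R,
    [/\ is_design (@chebyshev_density R) `](-1), 1[ 5 x,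
        rational_points x &
        antipodal x].
Proof.
have [s hs] := exists_half_design N_mod6 N_neq5 N_neq11.
have [sn us bs _ _] := hs.
have sz : size (antipodal_seq R s) == (2 * N + 1)%N.
  by rewrite /= size_cat !size_map sn mul2n -addnn addn1.
exists (Tuple sz); split.
- split.
  + exact: antipodal_seq_uniq.
  + by move=> i; rewrite in_itv/= (antipodal_seq_bound bs)// mem_tnth.
  + move=> f f6; rewrite chebyshev_integral//.
    rewrite -(big_tuple _ _ (Tuple sz) xpredT (horner f))/=.
    by rewrite (antipodal_seq_sum hs f6) mulKf// pnatr_eq0; lia.
- move=> i; have : tnth (Tuple sz) i \in antipodal_seq R s by exact: mem_tnth.
  rewrite inE mem_cat => /or3P[/eqP ->|/mapP[y _ ->]|/mapP[_ /mapP[y _ ->] ->]].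
  + by exists 0 => //; rewrite rmorph0.
  + by exists y.
  + by exists (- y) => //; rewrite rmorphN.
(* Negation fixes 0 and swaps the two halves of the list. *)
- move=> x; rewrite [RHS](_ : _ = (x \in map -%R (antipodal_seq R s)))//.
  rewrite [LHS](_ : _ = (x \in antipodal_seq R s))// /antipodal_seq/=.
  by rewrite oppr0 map_cat (mapK (@opprK R)) !inE !mem_cat [in RHS](orbC (_ \in _)).
Qed.
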